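(* Let $k\ge 1$ and $n>1$ be integers, and define $A_k(m)=(-1)^m\sum_{j=1}^{m-1}(-1)^{j+1}j^k$ for integers $m\ge 1$. Then the ratio $A_k(n+1)/A_k(n)$ is an integer if and only if at least one of the following conditions holds: (a) $n=2$; (b) $k=1$ and $n$ is even; (c) $k\in\{1,2\}$ and $n=3$.
   Context: Equivalently, $A_k(m)=(m-1)^k-(m-2)^k+(m-3)^k-\dots+(-1)^{m}\cdot 1^k$, which is positive for $m>1$, and $A_k(n+1)/A_k(n)$ equals $-(1^k-2^k+\dots+(-1)^{n+1}n^k)/(1^k-2^k+\dots+(-1)^n(n-1)^k)$. *)

(* Defs.v *)
From mathcomp Require Import all_boot all_order all_algebra.
Set Implicit Arguments.
Unset Strict Implicit.
Unset Printing Implicit Defensive.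
Import GRing.Theory Num.Theory.
Local Open Scope ring_scope.

Definition A (k m : nat) : int :=
  (-1) ^+ m * \sum_(1 <= j < m) (-1) ^+ j.+1 * j%:Z ^+ k.

(* Main.v *)
(* Since [A k n.+1 = n^k - A k n] with [A k n > 0], the ratio is an integer iff
   [A k n] divides [n^k], so that [A k n] is coprime to [n.-1].  For [n] odd,
   the odd part of [n.-1] divides [A k n.-1], hence [A k n], hence is [1];
   parity then forces [n = 3] and [2^k - 1] to be a power of [3].  For [n] and
   [k] even, [n.-1] itself divides [A k n], hence [n = 2].  For [n = 2m] and
   [k >= 3] odd, the 2-part of [A k n] is the square of that of [m], so [A k n]
   divides [m^k], which is smaller than [(n.-1)^k / 2 <= A k n] when [m > 1]. *)

Require Import Defs.
From mathcomp Require Import all_boot all_order all_algebra.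
From mathcomp Require Import zify ring lra.
Set Implicit Arguments.
Unset Strict Implicit.
Unset Printing Implicit Defensive.
Import GRing.Theory Num.Theory.
Local Open Scope ring_scope.

(** * Congruences between powers of integers *)

Lemma dvdz_add (d x y : int) : (d %| x)%Z -> (d %| y)%Z -> (d %| x + y)%Z.
Proof. exact: rpredD. Qed.

Lemma dvdz_taylor1 (x y : int) (k : nat) :
  (y ^+ 2 %| (x + y) ^+ k.+1 - x ^+ k.+1 - k.+1%:Z * y * x ^+ k)%Z.
Proof.
elim: k => [|k IHk].
  suff -> : (x + y) ^+ 1 - x ^+ 1 - 1%:Z * y * x ^+ 0 = 0 by exact: dvdz0.
  by ring.
have -> : (x + y) ^+ k.+2 - x ^+ k.+2 - k.+2%:Z * y * x ^+ k.+1 =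
    (x + y) * ((x + y) ^+ k.+1 - x ^+ k.+1 - k.+1%:Z * y * x ^+ k) +
    y ^+ 2 * (k.+1%:Z * x ^+ k).
  by rewrite !exprS (_ : k.+2%:Z = k.+1%:Z + 1); [ring | lia].
by rewrite dvdz_add //; [exact: dvdz_mull | exact: dvdz_mulr].
Qed.

Lemma dvdz_subrX (x y : int) (k : nat) : (x - y %| x ^+ k - y ^+ k)%Z.
Proof. by rewrite subrXX dvdz_mulr. Qed.

(** * Alternating power sums: splitting, shifting and reversal *)

Definition altsum (k n : nat) : int := \sum_(j < n) (-1) ^+ j * j%:Z ^+ k.

Lemma altsumS (k n : nat) :
  altsum k n.+1 = altsum k n + (-1) ^+ n * n%:Z ^+ k.
Proof. by rewrite /altsum big_ord_recr. Qed.

(** [altsum] drops the outer sign, which makes splitting at an index simple; its extra term [j = 0]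
    vanishes because [k > 0]. *)
Lemma A_altsum (k n : nat) : (0 < k)%N -> A k n = (-1) ^+ n.+1 * altsum k n.
Proof.
move=> k0; rewrite /A /altsum; case: n => [|n].
  by rewrite big_geq // big_ord0 !mulr0.
rewrite -[in RHS](big_mkord xpredT (fun j => (-1) ^+ j * j%:Z ^+ k)).
rewrite [in RHS]big_ltn // expr0n gtn_eqF //= mulr0 add0r.
rewrite [in RHS]exprS mulN1r mulNr -mulrN -sumrN; congr (_ * _).
by apply: eq_bigr => j _; rewrite exprS mulN1r mulNr.
Qed.

Lemma altsum_add (k m n : nat) :
  altsum k (m + n) =
  altsum k m + (-1) ^+ m * \sum_(j < n) (-1) ^+ j * (j%:Z + m%:Z) ^+ k.
Proof.
rewrite /altsum big_split_ord /= mulr_sumr; congr (_ + _).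
by apply: eq_bigr => j _; rewrite exprD mulrA PoszD [m%:Z + _]addrC.
Qed.

Lemma dvdz_altsum_shift (d : int) (k n m : nat) : (d %| m%:Z)%Z ->
  (d %| \sum_(j < n) (-1) ^+ j * (j%:Z + m%:Z) ^+ k - altsum k n)%Z.
Proof.
move=> dm; rewrite /altsum -sumrB; apply: rpred_sum => j _.
rewrite -mulrBr dvdz_mull // (dvdz_trans dm) //.
by have := dvdz_subrX (j%:Z + m%:Z) j%:Z k; rewrite addrAC subrr add0r.
Qed.

(* For [t = 0], the shift by [d] flips the sign of the terms because [d] is odd. *)
Lemma dvdz_altsum_even (k d t : nat) : odd d ->
  (d%:Z %| altsum k (2 ^ t.+1 * d))%Z.
Proof.
move=> od; elim: t => [|t IHt].
  rewrite expn1 mul2n -addnn altsum_add -signr_odd od expr1 mulN1r -opprB.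
  by rewrite rpredN dvdz_altsum_shift.
rewrite expnS -mulnA mul2n -addnn; set m := (2 ^ t.+1 * d)%N in IHt *.
rewrite altsum_add -signr_odd (_ : odd m = false) ?mul1r; last first.
  by rewrite /m expnS -mulnA oddM.
rewrite dvdz_add // -(subrK (altsum k m) (\sum_(j < m) _)) dvdz_add //.
by rewrite dvdz_altsum_shift // dvdzE /= dvdn_mull.
Qed.

Lemma alternating_sum_rev (F : nat -> int) (n : nat) :
  \sum_(j < n.+1) (-1) ^+ j * F j =
  (-1) ^+ n * \sum_(j < n.+1) (-1) ^+ j * F (n - j)%N.
Proof.
rewrite (reindex_inj rev_ord_inj) /= mulr_sumr.
apply: eq_bigr => j _; have jn : (j <= n)%N by rewrite -ltnS.
rewrite subSS mulrA -exprD; congr (_ * _).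
by rewrite -signr_odd -[RHS]signr_odd oddB // oddD.
Qed.

(** Reverse the sum over [j <= n]: the signs flip since [n] is odd, while [(n - j)^k] is [j^k]
    modulo [n] since [k] is even. So [n] divides twice the sum, and the 2 cancels. *)
Lemma dvdz_altsum_odd (k n : nat) : odd n -> ~~ odd k -> (0 < k)%N ->
  (n%:Z %| altsum k n)%Z.
Proof.
move=> on ek k0.
have := alternating_sum_rev (fun j => j%:Z ^+ k) n.
rewrite -/(altsum k n.+1) -signr_odd on expr1 mulN1r => rev.
have h : (n%:Z %| altsum k n.+1 - \sum_(j < n.+1) (-1) ^+ j * (n - j)%N%:Z ^+ k)%Z.
  rewrite /altsum -sumrB; apply: rpred_sum => j _.
  rewrite -mulrBr dvdz_mull // -opprB rpredN -subzn; last by rewrite -ltnS.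
  have := dvdz_subrX (n%:Z - j%:Z) (- j%:Z) k.
  by rewrite opprK subrK [in (- _) ^+ k]exprNn -signr_odd (negbTE ek) mul1r.
rewrite -[X in _ - X]opprK -rev opprK -mulr2n -mulr_natl Gauss_dvdzr in h; last first.
  by rewrite coprimezE /= coprimen2.
by move: h; rewrite altsumS rpredDr // dvdz_mull // dvdz_exp.
Qed.

(** * The exact power of 2 in [altsum k n] for even [n] *)

Lemma altsum_mod2 (k n : nat) : (0 < k)%N -> (2 %| altsum k n - n./2%:Z)%Z.
Proof.
move=> k0; elim: n => [|n IHn]; first by rewrite /altsum big_ord0.
rewrite altsumS.
(* The new term has the parity of [n], and [n.+1./2] exceeds [n./2] by [odd n]. *)
have -> : altsum k n + (-1) ^+ n * n%:Z ^+ k - n.+1./2%:Z =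
  (altsum k n - n./2%:Z) + ((-1) ^+ n * n%:Z ^+ k - (odd n)%:Z).
  by rewrite -uphalfE uphalf_half PoszD; ring.
rewrite dvdz_add // -signr_odd; case: (boolP (odd n)) => on /=.
  rewrite expr1 mulN1r -opprD rpredN.
  rewrite (_ : n%:Z ^+ k + 1 = n%:Z ^+ k - 1 ^+ k + 2); last by rewrite expr1n; ring.
  rewrite dvdz_add // (dvdz_trans _ (dvdz_subrX _ _ _)) //; lia.
rewrite mul1r subr0 dvdz_exp //; lia.
Qed.

(** In the Taylor expansion, the linear term gains a factor 2 from [e], and [m^2] gains one from
    [m]. *)
Lemma dvdz_expn_shift_even (x m : int) (e : nat) :
  (2 %| m)%Z -> ~~ odd e -> (0 < e)%N -> (2 * m %| (x + m) ^+ e - x ^+ e)%Z.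
Proof.
case: e => // k m2 ek _; rewrite -(subrK (k.+1%:Z * m * x ^+ k) (_ - _)).
rewrite dvdz_add //; last by rewrite dvdz_mulr // dvdz_mul //; lia.
apply: dvdz_trans (dvdz_taylor1 _ _ _).
by rewrite expr2 dvdz_mul.
Qed.

(** The 2-adic valuation is thus exactly [v]. Induction on [v]: doubling an even length [m] doubles
    the sum modulo [2m], a multiple of [2^(v+2)]. *)
Lemma altsum_even_valuation (e v o : nat) : odd o -> ~~ odd e -> (0 < e)%N ->
  (2 ^+ v.+1 %| altsum e (2 ^ v.+1 * o) - 2 ^+ v)%Z.
Proof.
move=> oo ee e0; elim: v => [|v IHv].
  have := altsum_mod2 (2 ^ 1 * o) e0; rewrite expn1 mul2n doubleK expr0 expr1 => h.
  by rewrite -(subrK o%:Z (altsum _ _)) -addrA dvdz_add //; lia.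
rewrite expnS -mulnA mul2n -addnn; set m := (2 ^ v.+1 * o)%N in IHv *.
have m2 : (2 %| m%:Z)%Z by rewrite dvdzE /m expnS -mulnA dvdn_mulr.
rewrite altsum_add -signr_odd (_ : odd m = false) ?mul1r; last lia.
have -> : altsum e m + \sum_(j < m) (-1) ^+ j * (j%:Z + m%:Z) ^+ e - 2 ^+ v.+1 =
    (\sum_(j < m) (-1) ^+ j * (j%:Z + m%:Z) ^+ e - altsum e m)
    + 2 * (altsum e m - 2 ^+ v) by rewrite exprS; ring.
rewrite dvdz_add //; last by rewrite exprS dvdz_mul.
apply: (@dvdz_trans (2 * m%:Z)).
  by rewrite exprS dvdz_mul // dvdzE /= /m abszX dvdn_mulr.
rewrite /altsum -sumrB; apply: rpred_sum => j _.
by rewrite -mulrBr dvdz_mull // dvdz_expn_shift_even.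
Qed.

(* Pair [j] with [2m - j]: [j^(k+1) + (2m - j)^(k+1)] is [2m (k+1) j^k] modulo
   [4m^2]. *)
Lemma dvdz_altsum_double (k m : nat) : ~~ odd k -> (1 < k)%N -> ~~ odd m ->
  (2 * m%:Z ^+ 2 %| altsum k.+1 (m + m) - 2 * m%:Z * k.+1%:Z * altsum k m)%Z.
Proof.
move=> ek k1 em.
have sg : (-1) ^+ m = 1 :> int by rewrite -signr_odd (negbTE em).
have m2 : (2 %| m%:Z)%Z by lia.
(* [B] is the upper half of the sum over [0..2m], read backwards from [2m]. *)
set K := k.+1; pose B := \sum_(j < m.+1) (-1) ^+ j * (m%:Z + m%:Z - j%:Z) ^+ K.
have eqB : altsum K (m + m) = altsum K m + B - (m%:Z + m%:Z) ^+ K.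
  have := altsumS K (m + m); rewrite -addnS altsum_add.
  rewrite (alternating_sum_rev (fun j => (j%:Z + m%:Z) ^+ K)) exprD sg !mul1r PoszD.
  have -> : \sum_(j < m.+1) (-1) ^+ j * ((m - j)%N%:Z + m%:Z) ^+ K = B.
    apply: eq_bigr => j _; congr (_ * _ ^+ _).
    by have := ltn_ord j; lia.
  by move=> ->; rewrite addrK.
(* This disposes of the boundary terms at [j = m] and [j = 2m]: [m] is even and [K >= 3]. *)
have m3 (c : int) : (2 * m%:Z ^+ 2 %| c * m%:Z ^+ K)%Z.
  case/dvdzP: m2 => q Eq; apply/dvdzP; exists (c * q * m%:Z ^+ k.-2).
  transitivity (c * (q * 2) * m%:Z ^+ 2 * m%:Z ^+ k.-2); last by ring.
  by rewrite -Eq -mulrA -exprD -mulrA -exprS; congr (_ * _ ^+ _); lia.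
have dB : (2 * m%:Z ^+ 2 %| B + altsum K m.+1 - 2 * m%:Z * K%:Z * altsum k m.+1)%Z.
  rewrite /B /altsum mulr_sumr -big_split -sumrB /=; apply: rpred_sum => j _.
  set s := (-1) ^+ j.
  have -> : s * (m%:Z + m%:Z - j%:Z) ^+ K + s * j%:Z ^+ K
            - 2 * m%:Z * K%:Z * (s * j%:Z ^+ k) =
       - s * ((j%:Z + (- (m%:Z + m%:Z))) ^+ K - j%:Z ^+ K
              - K%:Z * (- (m%:Z + m%:Z)) * j%:Z ^+ k).
    have -> : m%:Z + m%:Z - j%:Z = - (j%:Z + (- (m%:Z + m%:Z))) by ring.
    rewrite [(- _) ^+ K]exprNn -signr_odd (_ : odd K); last by rewrite /K /=.
    by rewrite expr1; ring.
  rewrite dvdz_mull // (dvdz_trans _ (dvdz_taylor1 _ _ _)) //.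
  by apply/dvdzP; exists 2; ring.
have -> : altsum K (m + m) - 2 * m%:Z * K%:Z * altsum k m =
    (B + altsum K m.+1 - 2 * m%:Z * K%:Z * altsum k m.+1)
    + (2 * K%:Z - 2 ^+ K - 1) * m%:Z ^+ K.
  have E2 : (m%:Z + m%:Z) ^+ K = 2 ^+ K * m%:Z ^+ K.
    by rewrite -exprMn; congr (_ ^+ _); ring.
  have EK : m%:Z ^+ K = m%:Z * m%:Z ^+ k by rewrite exprS.
  rewrite eqB !altsumS sg E2 EK; ring.
by rewrite dvdz_add.
Qed.

(** The valuation is exactly [2v]. For [v > 0] and [m = 2^v o], the sum is [2m (k+1) altsum k m]
    modulo [2m^2]; here [2m] contributes [v+1], [k+1] is odd, and [altsum k m] contributes [v-1]
    since [k] is even. *)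
Lemma altsum_odd_valuation (k v o : nat) : odd o -> ~~ odd k -> (1 < k)%N ->
  (2 ^+ (v.*2).+1 %| altsum k.+1 (2 ^ v.+1 * o) - 2 ^+ v.*2)%Z.
Proof.
move=> oo ek k1; case: v => [|v].
  have := altsum_mod2 (2 ^ 1 * o) (ltn0Sn k).
  rewrite expn1 mul2n doubleK expr0 expr1 => h.
  by rewrite -(subrK o%:Z (altsum _ _)) -addrA dvdz_add //; lia.
set m := (2 ^ v.+1 * o)%N.
have em : ~~ odd m by rewrite /m expnS -mulnA oddM.
have Em : m%:Z = 2 ^+ v.+1 * o%:Z by rewrite -!natz natrM natrX.
have := dvdz_altsum_double ek k1 em.
have := altsum_even_valuation v oo ek (ltnW k1); rewrite -/m => h1 h2.
rewrite expnS -mulnA mul2n -addnn -/m.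
have -> : altsum k.+1 (m + m) - 2 ^+ (v.+1).*2 =
  (altsum k.+1 (m + m) - 2 * m%:Z * k.+1%:Z * altsum k m)
  + 2 * m%:Z * k.+1%:Z * (altsum k m - 2 ^+ v)
  + 2 ^+ (v.+1).*2 * (o%:Z * k.+1%:Z - 1).
  rewrite Em doubleS -addnn !exprS exprD; ring.
have E : 2 ^+ (v.+1).*2.+1 = 2 * 2 ^+ v.+1 * 2 ^+ v.+1 :> int.
  by rewrite -addnn exprS exprD mulrA.
apply: dvdz_add; first apply: dvdz_add.
- by apply: dvdz_trans h2; rewrite E Em; apply/dvdzP; exists (o%:Z ^+ 2); ring.
- rewrite E dvdz_mul // dvdz_mulr // dvdz_mul // Em dvdz_mulr //.
- rewrite exprSr dvdz_mul //.
  have : odd (o * k.+1) by rewrite oddM oo /= ek.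
  lia.
Qed.

(** * Bounds and special values of [A] *)

Lemma convex_expn (y : int) (k : nat) : 0 <= y -> (0 < k)%N ->
  (y + 1) ^+ k *+ 2 <= y ^+ k + (y + 2) ^+ k.
Proof.
move=> y0; case: k => // k _; elim: k => [|k IHk]; first by rewrite !expr1; lia.
have h : y ^+ k.+1 <= (y + 2) ^+ k.+1 by apply: lerXn2r; rewrite ?nnegrE; lia.
have h' : (y + 1) * ((y + 1) ^+ k.+1 *+ 2) <= (y + 1) * (y ^+ k.+1 + (y + 2) ^+ k.+1).
  by apply: ler_wpM2l => //; lia.
rewrite 3!(exprS _ k.+1); nra.
Qed.

Lemma A_recr (k n : nat) : (0 < k)%N -> A k n.+1 = n%:Z ^+ k - A k n.
Proof.
move=> k0; rewrite !A_altsum // altsumS !exprS; set s := (-1) ^+ n.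
have ss : s * s = 1 by rewrite -expr2 sqrr_sign.
transitivity (s * s * n%:Z ^+ k - -1 * s * altsum k n); first by ring.
by rewrite ss mul1r.
Qed.

(** The recurrence swaps the bounds: the upper one gives the next lower one at once, the lower one
    gives the next upper one by convexity. *)
Lemma A_bounds (k n : nat) : (0 < k)%N ->
  n%:Z ^+ k <= A k n.+1 *+ 2 <= n.+1%:Z ^+ k.
Proof.
move=> k0; elim: n => [|n /andP[lo hi]].
  rewrite A_recr // A_altsum // /altsum big_ord0 mulr0 subr0.
  by rewrite expr0n gtn_eqF //= mul0rn exprn_ge0.
have c := @convex_expn n%:Z k isT k0.
have e1 : n%:Z + 1 = n.+1 by lia.
have e2 : n%:Z + 2 = n.+2 by lia.
rewrite e1 e2 in c; rewrite A_recr //; apply/andP; split; lia.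
Qed.

Lemma A_gt0 (k n : nat) : (0 < k)%N -> (1 < n)%N -> 0 < A k n.
Proof.
move=> k0; case: n => [|[|n]] // _; have /andP[lo _] := A_bounds n.+1 k0.
by have := exprn_gt0 k (isT : 0 < n.+1%:Z); lia.
Qed.

Lemma A_even_eq (k m : nat) : (0 < k)%N -> A k m.*2 = - altsum k m.*2.
Proof. by move=> k0; rewrite A_altsum // -signr_odd /= odd_double expr1 mulN1r. Qed.

Lemma A2 (k : nat) : (0 < k)%N -> A k 2 = 1.
Proof.
move=> k0; rewrite (A_even_eq 1) // !altsumS /altsum big_ord0.
by rewrite expr0n gtn_eqF // expr1n.
Qed.

Lemma A1_even (m : nat) : A 1 m.*2 = m%:Z.
Proof.
rewrite A_even_eq //; elim: m => [|m IHm]; first by rewrite /altsum big_ord0.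
rewrite doubleS !altsumS !opprD IHm !expr1 exprS -signr_odd odd_double expr0; lia.
Qed.

(** * Integrality as divisibility, and the cases by parity *)

Lemma A_ratio_int (k n : nat) : (0 < k)%N -> (1 < n)%N ->
  ((A k n.+1)%:Q / (A k n)%:Q \is a Num.int) <-> (A k n %| n%:Z ^+ k)%Z.
Proof.
move=> k0 n1; have A0 := A_gt0 k0 n1.
have A0' : (A k n)%:Q != 0 by rewrite intr_eq0 lt0r_neq0.
rewrite -(subrK (A k n) (n%:Z ^+ k)) -A_recr // rpredDr //.
split; last exact: Qint_dvdz.
case/intrP => q /(canRL (divfK A0')) /eqP.
by rewrite -intrM eqr_int => /eqP ->; rewrite dvdz_mull.
Qed.

(** Powers of 3 are 1 or 3 modulo 8, but [2^k - 1] is 7 once [k >= 3]. *)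
Lemma mersenne_pow3 (k e : nat) : (3 ^ e = 2 ^ k - 1)%N -> (k <= 2)%N.
Proof.
case: k => [|[|[|k]]] // E; exfalso.
have h : (3 ^ e %% 8 = 1 \/ 3 ^ e %% 8 = 3)%N.
  elim: e {E} => [|e IHe]; first by left.
  by rewrite expnS; lia.
have := expn_gt0 2 k; rewrite !expnS in E *; lia.
Qed.

Lemma half_power_lt (m k : nat) : (1 < m)%N -> (1 < k)%N ->
  (2 * m ^ k < (m.*2.-1) ^ k)%N.
Proof.
move=> m1; case: k => [|[|k]] // _; elim: k => [|k IHk]; first by nia.
rewrite !(expnS _ k.+2) mulnCA; apply: leq_trans (leq_mul (leqnn _) IHk).
have mc : (m <= m.*2.-1)%N by lia.
by apply: leq_ltn_trans (leq_mul mc (leqnn _)) _; rewrite ltn_pmul2l; lia.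
Qed.

(* Such a [d] divides [A k n.+1 = n^k - A k n], hence [n.+1^k], and is
   coprime to [n.+1]. *)
Lemma divisor_eq1 (k n d : nat) : (0 < k)%N -> (d %| n)%N ->
  (d%:Z %| altsum k n)%Z -> (A k n.+1 %| n.+1%:Z ^+ k)%Z -> d = 1%N.
Proof.
move=> k0 dn dS dA.
have : (d%:Z %| A k n.+1)%Z.
  rewrite A_recr // A_altsum // -mulNr; apply: dvdz_add; last exact: dvdz_mull.
  exact: dvdz_exp.
move=> /dvdz_trans /(_ dA); rewrite dvdzE abszX /= => dX.
have cd : coprime d (n.+1 ^ k) by rewrite coprimeXr // (coprime_dvdl dn) // coprimenS.
by apply/eqP; rewrite -dvdn1 -(eqP cd) dvdn_gcd dvdnn.
Qed.

Lemma A_odd_ratio (k n : nat) : (0 < k)%N -> odd n -> (1 < n)%N ->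
  (A k n %| n%:Z ^+ k)%Z -> (k <= 2)%N /\ n = 3%N.
Proof.
move=> k0; case: n => // N /= eN N0 dA.
have [d cd EN] := pfactor_coprime (isT : prime 2) N0.
have od : odd d by rewrite -coprime2n.
have [t Et] : exists t, logn 2 N = t.+1.
  exists (logn 2 N).-1; rewrite prednK // logn_gt0 mem_primes /=.
  by rewrite dvdn2 eN -ltnS N0.
rewrite Et mulnC in EN.
have d1 : d = 1%N.
  apply: (divisor_eq1 k0 _ _ dA); first by rewrite EN dvdn_mull.
  by rewrite EN dvdz_altsum_even.
have oA : ~~ (2 %| A k N.+1)%Z.
  apply/negP => /dvdz_trans /(_ dA); rewrite dvdzE abszX /= dvdn2 oddX /= eN.
  by rewrite orbT.
(* Now [n - 1 = 2^(t+1)], so [A k n] has the parity of [2^t]; being odd, it forces [t = 0]. *)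
have t0 : t = 0%N.
  have := altsum_mod2 N.+1 k0; have := oA.
  rewrite A_altsum // -signr_odd /= eN expr0 mul1r => h1 h2.
  have : odd (N.+1./2) by lia.
  rewrite EN d1 muln1 expnS mul2n /= uphalf_double oddX; by case: (t).
have EN2 : N = 2%N by rewrite EN d1 t0.
rewrite EN2 in dA *; split=> //; move: dA.
rewrite A_recr // A2 // dvdzE abszX.
have -> : `|2%:Z ^+ k - 1|%N = (2 ^ k - 1)%N.
  have := expn_gt0 2 k; have -> : 2%:Z ^+ k = (2 ^ k)%N by rewrite -[RHS]natz natrX.
  lia.
by case/(dvdn_pfactor _ _ (isT : prime 3)) => e _ /esym /mersenne_pow3.
Qed.

Lemma A_even_even (k n : nat) : (0 < k)%N -> ~~ odd k -> ~~ odd n -> (1 < n)%N ->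
  (A k n %| n%:Z ^+ k)%Z -> n = 2%N.
Proof.
move=> k0 ek; case: n => // N /= /negPn oN _ dA; congr _.+1.
exact: divisor_eq1 (dvdnn N) (dvdz_altsum_odd oN ek k0) dA.
Qed.

Lemma A_even_odd (k m : nat) : (1 < k)%N -> odd k -> (1 < m)%N ->
  ~~ (A k m.*2 %| m.*2%:Z ^+ k)%Z.
Proof.
move=> k1 ok m1; apply/negP => dA; have k0 := ltnW k1.
have [o co Em] := pfactor_coprime (isT : prime 2) (ltnW m1).
have oo : odd o by rewrite -coprime2n.
set v := logn 2 m in Em; rewrite mulnC in Em.
have Em2 : m.*2 = (2 ^ v.+1 * o)%N by rewrite -mul2n {1}Em mulnA expnS.
have /dvdzP[q Eq] : (2 ^+ (v.*2).+1 %| altsum k m.*2 - 2 ^+ v.*2)%Z.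
  rewrite Em2; case: (k) k1 ok => // k' k'1 ok'.
  by apply: altsum_odd_valuation => //; case: k' k'1 ok' => [|[]].
(* [w] is the odd cofactor of [2^(2v)] in [A k m.*2]. *)
set w := - (2 * q + 1).
have EA : A k m.*2 = 2 ^+ v.*2 * w.
  rewrite A_even_eq // -(subrK (2 ^+ v.*2) (altsum k m.*2)) Eq exprS /w; ring.
have ow : coprimez 2 w.
  by rewrite coprimezE /= coprime2n /w; lia.
have dw : (w %| m%:Z ^+ k)%Z.
  have : (w %| m.*2%:Z ^+ k)%Z by apply: dvdz_trans dA; rewrite EA dvdz_mull.
  have -> : m.*2%:Z = 2 * m%:Z by lia.
  by rewrite exprMn Gauss_dvdzr // coprimezXr // coprimez_sym.
(* The 2-part [2^(2v)] divides [2^(vk)] as [k >= 2], and [w] is coprime to it. *)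
have dm : (A k m.*2 %| m%:Z ^+ k)%Z.
  rewrite EA Gauss_dvdz ?coprimezXl // dw andbT Em PoszM exprMn dvdz_mulr //.
  have -> : (2 ^ v)%N%:Z = 2 ^+ v by rewrite -[LHS]natz natrX.
  by rewrite -exprM dvdz_exp2l // -muln2 leq_mul2l k1 orbT.
have A0 : 0 < A k m.*2 by rewrite A_gt0 //; lia.
(* Size contradiction: [2 m^k < (2m-1)^k <= 2 A k m.*2]. *)
have /andP[lo _] := A_bounds m.*2.-1 k0.
have hlt := half_power_lt m1 k1.
rewrite prednK in lo; last lia.
move: dm; rewrite dvdzE abszX /= => /dvdn_leq; rewrite expn_gt0 (ltnW m1) /=.
move=> /(_ isT) le.
have EX : m.*2.-1%:Z ^+ k = (m.*2.-1 ^ k)%N by rewrite -[RHS]natz natrX natz.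
rewrite EX in lo; lia.
Qed.

Theorem theorem1 (k n : nat) (hk : (1 <= k)%N) (hn : (1 < n)%N) :
  ((A k n.+1)%:Q / (A k n)%:Q \is a Num.int) <->
  [\/ n = 2%N, k = 1%N /\ ~~ odd n | (k = 1%N \/ k = 2%N) /\ n = 3%N].
Proof.
apply: iff_trans (A_ratio_int hk hn) _; split=> [dA|].
  have [on|en] := boolP (odd n).
    by have [k2 ->] := A_odd_ratio hk on hn dA; apply: Or33; split => //; lia.
  have [ok|ek] := boolP (odd k); last by apply: Or31; exact: A_even_even dA.
  have [k1|k1] := leqP k 1; first by apply: Or32; split => //; lia.
  have [m Em] : exists m, n = m.*2 by exists n./2; lia.
  have [m1|m1] := leqP m 1; first by apply: Or31; lia.
  by move: dA; rewrite Em (negbTE (A_even_odd k1 ok m1)).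
(* Conversely, the divisor is 1 for [n = 2], [n/2] for [k = 1] and [n] even, and [2^k - 1], that is
   1 or 3, for [n = 3]. *)
case=> [->|[-> en]|[[]-> ->]].
- by rewrite A2 // dvd1z.
- by rewrite -(even_halfK en) A1_even expr1 -muln2 PoszM dvdz_mulr.
- by rewrite A_recr // A2.
- by rewrite A_recr // A2.
Qed.
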